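(* Let $E$ be a countably Dedekind complete Riesz space, let $b\in E$ with $0<b$, let $V=[0,b]$, and let $(V,\mathbb T)$ with $\mathbb T=\{T_\sigma:\sigma\in\Sigma\}$ be a regular abstract dynamic program. If $(V,\mathbb T)$ is order continuous, every $T_\sigma\in\mathbb T$ is concave on $V$, and, for every $T_\sigma\in\mathbb T$, $T_\sigma v\ne v$ whenever $v\in\partial V$, then (i) the fundamental optimality properties hold for $(V,\mathbb T)$, and (ii) VFI, OPI and HPI all converge.
   Context: For elements $v\le w$ of a poset, $[v,w]=\{u:v\le u\le w\}$ is an order interval. A Riesz space $E$ is countably Dedekind complete if, in every order interval, every countable chain has a supremum and an infimum in that interval. $0<b$ means $0\le b$ and $b\ne0$. The lower perimeter of $V=[0,b]$ is $\partial V=\{v\in V:\ \alpha\in\mathbb R_+ \text{ and } \alpha b\le v \text{ imply } \alpha=0\}$. A self-map $S$ on $V$ is concave if $\lambda Sv+(1-\lambda)Sw\le S(\lambda v+(1-\lambda)w)$ for all $v,w\in V$, $\lambda\in[0,1]$. Write $v_n\uparrow v$ if $(v_n)$ is increasing with supremum $v$. A self-map $S$ on $V$ is order continuous if $v_n\uparrow v$ in $V$ implies $Sv_n\uparrow Sv$; $(V,\mathbb T)$ is order continuous if each $T_\sigma\in\mathbb T$ is order continuous on $V$. Abstract dynamic programs. An abstract dynamic program (ADP) is a pair $(V,\mathbb T)$ where $V=(V,\preceq)$ is a poset (here $\preceq$ is the order inherited from $E$) and $\mathbb T=\{T_\sigma:\sigma\in\Sigma\}$ is a nonempty family of order preserving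 self-maps on $V$; elements of $\Sigma$ are called policies. Given $v\in V$, $\sigma\in\Sigma$ is $v$-greedy if $T_\tau v\preceq T_\sigma v$ for all $\tau\in\Sigma$. The Bellman operator is $Tv:=\bigvee_\sigma T_\sigma v$ whenever the supremum exists; $v\in V$ solves the Bellman equation if $Tv$ exists and $Tv=v$. $(V,\mathbb T)$ is well-posed if each $T_\sigma$ has a unique fixed point $v_\sigma$ in $V$, and regular if a $v$-greedy policy exists for every $v\in V$. When $(V,\mathbb T)$ is well-posed, $V_\Sigma:=\{v_\sigma:\sigma\in\Sigma\}$; $\sigma$ is optimal if $v_\sigma$ is a greatest element of $V_\Sigma$; and the value function is $v^*:=\bigvee V_\Sigma$ whenever the supremum exists. Bellman's principle of optimality holds if $(V,\mathbb T)$ is well-posed and $\{\sigma\in\Sigma:\sigma\text{ is optimal}\}=\{\sigma\in\Sigma:\sigma\text{ is }v^*\text{-greedy}\}$ (both sets understood as empty if $v^*$ does not exist). The fundamental optimality properties hold if $(V,\mathbb T)$ is well-posed and regular and: (B1) at least one optimal policy exists; (B2) $v^*$ is the unique solution to the Bellman equation in $V$; (B3) Bellman's principle of optimality holds. Algorithms. Fix, for each $v\in V$, a choice of $v$-greedy policy $\sigma$. Set $Hv:=v_\sigma$ (Howard policy operator) and, for $m\in\mathbb N$, $m\ge1$, $W_mv:=T_\sigma^m v$ (optimistic policy operator), where $\sigma$ is the chosen $v$-greedy policy. Let $V_U=\{v\in V:v\preceq Tv\}$. VFI converges if $T^nv\uparrow v^*$ for all $v\in V_U$; OPI converges if $W_m^nv\uparrow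 v^*$ for all $v\in V_U$ (for each $m$); HPI converges if $H^nv\uparrow v^*$ for all $v\in V_U$. *)

(* Defs.v *)
From HB Require Import structures.
From mathcomp Require Import all_boot all_order all_algebra.
From mathcomp Require Import boolp classical_sets functions cardinality reals.

Set Implicit Arguments.
Unset Strict Implicit.
Unset Printing Implicit Defensive.

Import Order.TTheory GRing.Theory Num.Theory.

Section Posets.
Local Open Scope order_scope.
Local Open Scope classical_set_scope.
Context {d : Order.disp_t} {V : porderType d}.

Definition increases_to (u : nat -> V) (v : V) : Prop :=
  (forall m n, (m <= n)%N -> u m <= u n) /\ supremums (range u) v.

Definition order_continuous (S : V -> V) : Prop :=
  forall (u : nat -> V) (v : V),
    increases_to u v -> increases_to (S \o u) (S v).

Definition countable_chain (C : set V) : Prop :=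
  countable C /\ total_on C (fun x y => x <= y).

End Posets.

(* The operators are indexed by policies: distinct policies may share the same
   operator. *)
Record adp (d : Order.disp_t) (V : porderType d) := ADP {
  policy : Type;
  policy_op :> policy -> V -> V;
  policy_inhabited : inhabited policy;
  policy_op_homo : forall s v w, (v <= w)%O -> (policy_op s v <= policy_op s w)%O
}.

(* The Bellman operator, the values v_σ and the value function v* are partial.
   Each is represented by its graph: "[bellman_value A v w]" reads
   "Tv exists and Tv = w", etc. *)
Section AbstractDynamicPrograms.
Local Open Scope order_scope.
Local Open Scope classical_set_scope.
Context {d : Order.disp_t} {V : porderType d} (A : adp V).

Definition greedy (v : V) (s : policy A) : Prop := forall t, A t v <= A s v.

Definition regular : Prop := forall v, exists s, greedy v s.

Definition bellman_value (v w : V) : Prop :=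
  supremums (range (fun s : policy A => A s v)) w.

Definition solves_bellman (v : V) : Prop := bellman_value v v.

Definition policy_value (s : policy A) (v : V) : Prop :=
  unique (fun w => A s w = w) v.

Definition well_posed : Prop := forall s, exists v, policy_value s v.

Definition policy_values : set V := [set v | exists s, policy_value s v].

Definition value_function (v : V) : Prop := supremums policy_values v.

Definition optimal (s : policy A) : Prop :=
  exists2 v, policy_value s v & ubound policy_values v.

Definition bellman_principle : Prop :=
  well_posed /\
  [set s | optimal s] = [set s | exists2 v, value_function v & greedy v s].

Record fundamental_optimality : Prop := FundamentalOptimality {
  fo_well_posed : well_posed;
  fo_regular : regular;
  fo_optimal : exists s, optimal s;
  fo_bellman : exists2 v, value_function v & unique solves_bellman v;
  fo_principle : bellman_principle
}.

Definition improvable : set V := [set v | exists2 w, bellman_value v w & v <= w].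

Definition iterates_converge (F : V -> V) : Prop :=
  exists2 vstar, value_function vstar &
    forall v, improvable v -> increases_to (fun n => iter n F v) vstar.

Definition greedy_selection (g : V -> policy A) : Prop :=
  forall v, greedy v (g v).

Definition VFI_converges : Prop :=
  exists2 T : V -> V, (forall v, bellman_value v (T v)) & iterates_converge T.

Definition optimistic_op (g : V -> policy A) (m : nat) (v : V) : V :=
  iter m (A (g v)) v.

Definition OPI_converges (g : V -> policy A) : Prop :=
  forall m, (1 <= m)%N -> iterates_converge (optimistic_op g m).

Definition HPI_converges (g : V -> policy A) : Prop :=
  exists2 H : V -> V, (forall v, policy_value (g v) (H v)) & iterates_converge H.

End AbstractDynamicPrograms.

Local Open Scope ring_scope.

HB.mixin Record isOrderedLmodule (R : numDomainType) E
    of GRing.Lmodule R E & Num.POrderedZmodule E := {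
  ovsD2r : forall z x y : E, x <= y -> x + z <= y + z;
  ovs_scale_ge0 : forall (a : R) (x : E), 0 <= a -> 0 <= x -> 0 <= a *: x
}.

#[short(type="orderedLmodType")]
HB.structure Definition OrderedLmodule (R : numDomainType) :=
  { E of isOrderedLmodule R E & GRing.Lmodule R E & Num.POrderedZmodule E }.

(* The lattice operations are restated here rather than inherited from
   Order.Lattice: Num.RealDomain already joins Order.Lattice with the additive
   structures, so that Hierarchy Builder rejects any later such join. *)
HB.mixin Record OrderedLmodule_isRiesz (R : numDomainType) E
    of OrderedLmodule R E := {
  riesz_meet : E -> E -> E;
  riesz_join : E -> E -> E;
  riesz_lexI : forall x y z : E, (z <= riesz_meet x y) = (z <= x) && (z <= y);
  riesz_leUx : forall x y z : E, (riesz_join x y <= z) = (x <= z) && (y <= z)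
}.

#[short(type="rieszType")]
HB.structure Definition Riesz (R : numDomainType) :=
  { E of OrderedLmodule_isRiesz R E & OrderedLmodule R E }.

Record order_interval (d : Order.disp_t) (E : porderType d) (v w : E) :=
  OrderInterval { oival : E; oivalP : (v <= oival <= w)%O }.

HB.instance Definition _ d (E : porderType d) (v w : E) :=
  [isSub for @oival d E v w].
HB.instance Definition _ d (E : porderType d) (v w : E) :=
  [Choice of order_interval v w by <:].
HB.instance Definition _ d (E : porderType d) (v w : E) :=
  [SubChoice_isSubPOrder of order_interval v w by <: with d].

(* Suprema and infima are taken in the poset [v, w], so that the empty chain
   is harmless. *)
Definition countably_dedekind_complete (R : numDomainType) (E : rieszType R) : Prop :=
  forall (v w : E), v <= w ->
  forall C : set (order_interval v w), countable_chain C ->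
    (exists s, supremums C s) /\ (exists i, infimums C i).

Section RieszIntervals.
Context {R : numDomainType} {E : rieszType R}.

Fact order_interval_conv_subproof (p q : E) (v w : order_interval p q) (a : R) :
  0 <= a <= 1 -> p <= a *: (val v : E) + (1 - a) *: (val w : E) <= q.
Proof.
move=> /andP[a0 a1].
have a1' : 0 <= 1 - a by rewrite subr_ge0.
have lesub (x y : E) : x <= y -> 0 <= y - x.
  by move=> /(ovsD2r (- x)); rewrite subrr.
have scl (c : R) (x y : E) : 0 <= c -> x <= y -> c *: x <= c *: y.
  move=> c0 /lesub xy.
  have /(ovsD2r (c *: x)) := ovs_scale_ge0 _ _ c0 xy.
  by rewrite add0r scalerBr subrK.
have cvx (x : E) : x = a *: x + (1 - a) *: x.
  by rewrite -scalerDl addrC subrK scale1r.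
have add (x y z t : E) : x <= y -> z <= t -> x + z <= y + t.
  move=> xy zt; apply: (le_trans (ovsD2r z _ _ xy)).
  by rewrite ![y + _]addrC; exact: ovsD2r.
have /andP[pv vq] := oivalP v; have /andP[pw wq] := oivalP w.
have lo : a *: p + (1 - a) *: p <= a *: val v + (1 - a) *: val w by rewrite add ?scl.
have hi : a *: val v + (1 - a) *: val w <= a *: q + (1 - a) *: q by rewrite add ?scl.
by move: lo hi; rewrite -!cvx => -> ->.
Qed.

Definition order_interval_conv (p q : E) (v w : order_interval p q) (a : R)
    (a01 : 0 <= a <= 1) : order_interval p q :=
  OrderInterval (order_interval_conv_subproof v w a01).

Definition concave_on_interval (p q : E)
    (S : order_interval p q -> order_interval p q) : Prop :=
  forall (v w : order_interval p q) (a : R) (a01 : 0 <= a <= 1),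
    a *: (val (S v) : E) + (1 - a) *: (val (S w) : E)
      <= (val (S (order_interval_conv v w a01)) : E).

Definition lower_perimeter (b : E) : set (order_interval 0 b) :=
  [set v | forall a : R, 0 <= a -> a *: b <= (val v : E) -> a = 0]%classic.

End RieszIntervals.

(* Main.v *)
(** Each [A s] is Scott continuous on an omega-complete interval, so Kleene
iteration from any [v <= A s v] reaches a fixed point, and iteration from [0]
reaches the least point [p] with [A s p <= p].  If [w] is another fixed point,
then [p <= w]; as [p] is off the lower perimeter, the line from [w] through [p]
can be extended slightly beyond [p] to a point [u] of the interval.  Concavity
along this line gives [A s u <= u], hence [p <= u], which forces [w <= p].
So the program is well-posed.  The Bellman operator inherits Scott continuity
from the policy operators, and its least fixed point is the value function. *)
Require Import Defs.
From HB Require Import structures.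
From mathcomp Require Import all_boot all_order all_algebra.
From mathcomp Require Import boolp classical_sets functions cardinality reals.

Set Implicit Arguments.
Unset Strict Implicit.
Unset Printing Implicit Defensive.

Import Order.TTheory GRing.Theory Num.Theory.

(** * Kleene iteration in omega-complete posets *)

Section Kleene.
Local Open Scope order_scope.
Local Open Scope classical_set_scope.
Context {d : Order.disp_t} {V : porderType d}.

Definition omega_complete : Prop :=
  forall u : nat -> V, (forall m n, (m <= n)%N -> u m <= u n) ->
  exists s, increases_to u s.

Lemma increases_to_ub (u : nat -> V) v n : increases_to u v -> u n <= v.
Proof. by move=> [_ [ub _]]; apply: ub; exists n. Qed.

Lemma increases_to_least (u : nat -> V) v w :
  increases_to u v -> (forall n, u n <= w) -> v <= w.
Proof. by move=> [_ [_ lub]] uw; apply: lub => _ [n _ <-]. Qed.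

Lemma increases_to_intro (u : nat -> V) v :
  (forall n, u n <= u n.+1) -> (forall n, u n <= v) ->
  (forall w, (forall n, u n <= w) -> v <= w) -> increases_to u v.
Proof.
move=> uS uv lub; split.
  by apply: (homo_leq (r := fun x y => x <= y)) => // y x z; exact: le_trans.
by split=> [_ [n _ <-] //|w ubw]; apply: lub => n; apply: ubw; exists n.
Qed.

Context (S : V -> V) (S_homo : {homo S : x y / x <= y}).

Lemma iter_le_homo n : {homo iter n S : x y / x <= y}.
Proof. by move=> x y xy; elim: n => //= n; exact: S_homo. Qed.

Lemma iter_leS v n : v <= S v -> iter n S v <= iter n.+1 S v.
Proof. by move=> vS; rewrite iterSr; exact: iter_le_homo. Qed.

Lemma iter_le_prefixed v w n : v <= w -> S w <= w -> iter n S v <= w.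
Proof. by move=> vw Sw; elim: n => //= n /S_homo/le_trans; apply. Qed.

Lemma kleene_fixed_point v : omega_complete -> order_continuous S ->
  v <= S v -> exists2 w, increases_to (fun n => iter n S v) w & S w = w.
Proof.
move=> cV cS vS.
have [w ivw] : exists w, increases_to (fun n => iter n S v) w.
  apply: cV; apply: (homo_leq (r := fun x y => x <= y)) => [//|y x z|n]; [exact: le_trans|exact: iter_leS].
(* By continuity [S w] is the supremum of the same iterates shifted by one, so the two suprema
   agree. *)
exists w => //; have iSw := cS _ _ ivw; apply/le_anti/andP; split.
  by apply: (increases_to_least iSw) => n; exact: (increases_to_ub n.+1 ivw).
apply: (increases_to_least ivw) => n.
by apply: le_trans (iter_leS n vS) _; exact: (increases_to_ub n iSw).
Qed.

End Kleene.
Arguments omega_complete {d} V.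

(** * Optimality and convergence for well-posed programs *)

Section WellPosedPrograms.
Local Open Scope order_scope.
Local Open Scope classical_set_scope.
Context {d : Order.disp_t} {V : porderType d} (A : adp V) (bot : V).
Hypotheses (botP : forall v, bot <= v) (cV : omega_complete V).
Hypotheses (regA : regular A) (ocA : forall s, order_continuous (A s)).
Hypothesis (wpA : well_posed A).

Lemma policy_op_mono s : {homo A s : v w / v <= w}.
Proof. exact: policy_op_homo. Qed.

Lemma policy_value_eq s v w : policy_value s v -> A s w = w -> w = v.
Proof. by move=> [_ uv] /uv. Qed.

Lemma policy_value_fixed s v : policy_value s v -> A s v = v.
Proof. by case. Qed.

Lemma policy_value_of_fixed s w : A s w = w -> policy_value s w.
Proof. by move=> fw; have [v sv] := wpA s; rewrite (policy_value_eq sv fw). Qed.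

(** Iterates from [bot] never pass [w], and by uniqueness their limit is [v]. The dual bound below
    iterates from [w] itself. *)
Lemma policy_value_le s v w : policy_value s v -> A s w <= w -> v <= w.
Proof.
move=> sv Aw.
have [x ix fx] := kleene_fixed_point (@policy_op_mono s) cV (@ocA s)
  (botP _).
rewrite -(policy_value_eq sv fx); apply: (increases_to_least ix) => n.
exact: iter_le_prefixed (@policy_op_mono s) _ _ _ (botP w) Aw.
Qed.

Lemma policy_value_ge s v w : policy_value s v -> w <= A s w -> w <= v.
Proof.
move=> sv wA.
have [x ix fx] := kleene_fixed_point (@policy_op_mono s) cV (@ocA s) wA.
by rewrite -(policy_value_eq sv fx); exact: (increases_to_ub 0 ix).
Qed.

Context (g : V -> policy A) (gP : greedy_selection g).

(** The supremum over policies is attained at a greedy one, so a selection makes the Bellman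
    operator total; by [bellman_valueE] the result does not depend on [g]. *)
Definition bellman_op (v : V) : V := A (g v) v.
Local Notation T := bellman_op.

Lemma policy_op_le_bellman_op s v : A s v <= T v.
Proof. exact: gP. Qed.

Lemma bellman_opP v : bellman_value A v (T v).
Proof. by split=> [_ [s _ <-]|w]; [exact: gP|apply; exists (g v)]. Qed.

Lemma bellman_valueE v w : bellman_value A v w -> w = T v.
Proof.
by have [ubT lubT] := bellman_opP v => -[ubw lubw];
  apply/le_anti/andP; split; [exact: lubw|exact: lubT].
Qed.

Lemma greedyE v s : greedy v s <-> A s v = T v.
Proof.
split=> [sg|Asv t]; last by rewrite Asv policy_op_le_bellman_op.
by apply/le_anti/andP; split; [exact: gP|exact: sg].
Qed.

Lemma improvableE v : improvable A v <-> v <= T v.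
Proof.
split=> [[w /bellman_valueE-> //]|vT].
by exists (T v) => //; exact: bellman_opP.
Qed.

Lemma bellman_op_homo : {homo T : v w / v <= w}.
Proof.
move=> v w vw; apply: le_trans (policy_op_le_bellman_op (g v) w).
exact: policy_op_homo.
Qed.

(** Only the policy greedy at the limit [v] matters: [T v] is the supremum of [A (g v) (u n)], each
    below [T (u n)]. *)
Lemma bellman_op_order_continuous : order_continuous T.
Proof.
move=> u v uv; apply: increases_to_intro => [n|n|w Tw] /=.
- by apply: bellman_op_homo; case: uv => /(_ n n.+1 (leqnSn n)).
- by apply: bellman_op_homo; exact: increases_to_ub uv.
apply: (increases_to_least (@ocA (g v) _ _ uv)) => n.
exact: le_trans (policy_op_le_bellman_op _ _) (Tw n).
Qed.

Lemma bellman_op_fixed_value w : T w = w -> policy_value (g w) w.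
Proof. exact: policy_value_of_fixed. Qed.

Lemma bellman_op_fixed_ub w : T w = w -> ubound (policy_values A) w.
Proof.
move=> Tw v [s sv]; apply: (policy_value_le sv).
by rewrite -[leRHS]Tw policy_op_le_bellman_op.
Qed.

(** A Bellman fixed point is both a policy value and an upper bound of all policy values. *)
Lemma bellman_op_fixed_unique v w : T v = v -> T w = w -> v = w.
Proof.
move=> Tv Tw; apply/le_anti/andP; split; apply: bellman_op_fixed_ub => //;
by [exists (g v); exact: bellman_op_fixed_value
   |exists (g w); exact: bellman_op_fixed_value].
Qed.

Lemma bellman_op_fixed_value_function w : T w = w -> value_function A w.
Proof.
move=> Tw; split; first exact: bellman_op_fixed_ub.
by move=> v; apply; exists (g w); exact: bellman_op_fixed_value.
Qed.

Lemma value_function_unique v w :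
  value_function A v -> value_function A w -> v = w.
Proof.
by move=> [ubv lubv] [ubw lubw]; apply/le_anti/andP; split;
  [exact: lubv|exact: lubw].
Qed.

Lemma bellman_op_iterates v : v <= T v ->
  exists2 w, increases_to (fun n => iter n T v) w & T w = w.
Proof.
by apply: kleene_fixed_point => //;
  [exact: bellman_op_homo|exact: bellman_op_order_continuous].
Qed.

Lemma well_posed_fundamental_optimality : fundamental_optimality A.
Proof.
have [p _ Tp] := bellman_op_iterates (botP _).
have pV := bellman_op_fixed_value_function Tp.
have gp := bellman_op_fixed_value Tp.
split=> //.
- by exists (g p); exists p => //; exact: bellman_op_fixed_ub.
- exists p => //; split=> [|w /bellman_valueE Tw].
    by rewrite /solves_bellman -{2}Tp; exact: bellman_opP.
  exact: bellman_op_fixed_unique.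
(* Both sets consist of the policies [s] with [A s p = p]. *)
split=> //; apply/seteqP; split=> s /=.
  move=> [v sv ubv]; exists p => //; apply/greedyE; rewrite Tp.
  have -> : p = v.
    apply/le_anti/andP; split; first by apply: ubv; exists (g p).
    by apply: pV.1; exists s.
  exact: policy_value_fixed.
move=> [v vV /greedyE]; rewrite (value_function_unique vV pV) Tp => fp.
exists p; [exact: policy_value_of_fixed|exact: bellman_op_fixed_ub].
Qed.

(* Sandwich: the iterates of [F] lie between those of [T] and the value
   function. *)
Lemma iterates_converge_between (F : V -> V) :
  (forall v, v <= T v -> [/\ T v <= F v, F v <= T (F v) &
     forall w, T w = w -> F v <= w]) ->
  iterates_converge A F.
Proof.
move=> FP; have [p _ Tp] := bellman_op_iterates (botP _).
exists p; first exact: bellman_op_fixed_value_function.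
move=> v /improvableE vT.
have FT n : iter n F v <= T (iter n F v).
  by elim: n => //= n /FP[].
have TF n : iter n T v <= iter n F v.
  elim: n => //= n /bellman_op_homo/le_trans; apply.
  by have [] := FP _ (FT n).
have [q vq Tq] := bellman_op_iterates vT.
(* Uniqueness of the Bellman fixed point makes the limit independent of the starting point. *)
rewrite -(bellman_op_fixed_unique Tq Tp).
apply: increases_to_intro => [n|[|n]|w Fw] /=.
- by have [/(le_trans (FT n))] := FP _ (FT n).
- exact: (increases_to_ub 0 vq).
- by have [_ _] := FP _ (FT n); exact.
by apply: (increases_to_least vq) => n; exact: le_trans (TF n) (Fw n).
Qed.

Lemma policy_value_le_bellman_fixed (s : policy A) v w :
  policy_value s v -> T w = w -> v <= w.
Proof. by move=> sv Tw; apply: (bellman_op_fixed_ub Tw); exists s. Qed.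

Lemma well_posed_VFI_converges : VFI_converges A.
Proof.
exists T; first exact: bellman_opP.
apply: iterates_converge_between => v vT; split=> // [|w Tw].
  exact: bellman_op_homo.
rewrite -[leRHS]Tw; apply: bellman_op_homo.
have [x gx] := wpA (g v); apply: le_trans (policy_value_ge gx vT) _.
exact: policy_value_le_bellman_fixed gx Tw.
Qed.

Lemma well_posed_OPI_converges : OPI_converges g.
Proof.
(* From here on the number of policy steps is [m.+1]; the first of them already yields [T v]. *)
move=> [//|m] _; apply: iterates_converge_between => v vT.
have homo := @policy_op_mono (g v).
have up n : v <= iter n (A (g v)) v.
  by elim: n => //= n /homo/(le_trans vT).
split=> [||w Tw].
- exact: homo (up m).
- apply: le_trans (policy_op_le_bellman_op (g v) _).
  exact: (iter_leS homo m.+1 vT).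
have [x gx] := wpA (g v).
apply: le_trans (policy_value_le_bellman_fixed gx Tw).
apply: (iter_le_prefixed homo); first exact: policy_value_ge gx vT.
by rewrite (policy_value_fixed gx).
Qed.

Lemma well_posed_HPI_converges : HPI_converges g.
Proof.
have [H HP] := choice (fun v => wpA (g v)).
exists H => //; apply: iterates_converge_between => v vT.
have HvE := policy_value_fixed (HP v).
split=> [||w]; last exact: policy_value_le_bellman_fixed (HP v).
(* Since [v <= H v], one step of the policy [g v] gives [T v <= A (g v) (H v) = H v]. *)
- by rewrite -HvE; apply: policy_op_homo; exact: policy_value_ge (HP v) vT.
by rewrite -{1}HvE; exact: policy_op_le_bellman_op.
Qed.

End WellPosedPrograms.

(** * Order intervals in Riesz spaces and concave self-maps *)

Section OrderIntervals.
Local Open Scope ring_scope.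
Context {R : realType} {E : rieszType R}.

Lemma omega_complete_order_interval (p q : E) :
  countably_dedekind_complete E -> p <= q ->
  omega_complete (order_interval p q).
Proof.
move=> cE pq u u_homo.
have [|[s sP] _] := cE _ _ pq (range u); last by exists s.
split; first exact: card_image_le.
move=> _ _ [m _ <-] [n _ <-].
by have [mn|/ltnW nm] := leqP m n; [left|right]; exact: u_homo.
Qed.

Lemma riesz_subr_ge0 (x y : E) : (0 <= y - x) = (x <= y).
Proof.
apply/idP/idP => [/(ovsD2r x)|/(ovsD2r (- x))]; first by rewrite add0r subrK.
by rewrite subrr.
Qed.

Lemma riesz_scale_le (a : R) (x y : E) : 0 <= a -> x <= y -> a *: x <= a *: y.
Proof.
move=> a0; rewrite -riesz_subr_ge0 => /(ovs_scale_ge0 _ _ a0).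
by rewrite scalerBr riesz_subr_ge0.
Qed.

Lemma riesz_scale_le_inv (a : R) (x y : E) :
  0 < a -> a *: x <= a *: y -> x <= y.
Proof.
move=> a0 /(riesz_scale_le (ltW _)) - /(_ a^-1).
by rewrite invr_gt0 !scalerA mulVf ?gt_eqF// !scale1r => /(_ a0).
Qed.

Lemma not_lower_perimeter (b : E) (v : order_interval 0 b) :
  ~ lower_perimeter v -> exists2 a : R, 0 < a & a *: b <= val v.
Proof.
move=> vP; apply: contrapT => nex; apply: vP => a a0 av.
apply: contrapT => /eqP aN0; apply: nex; exists a => //.
by rewrite lt_neqAle eq_sym aN0.
Qed.

Lemma concave_fixed_point_unique (b : E)
    (S : order_interval 0 b -> order_interval 0 b) (p w : order_interval 0 b) :
  concave_on_interval S -> ~ lower_perimeter p ->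
  (forall u, S u <= u -> p <= u)%O -> S p = p -> S w = w -> p = w.
Proof.
move=> cS /not_lower_perimeter[t t0 tp] p_least Sp Sw.
have pw : (p <= w)%O by apply: p_least; rewrite Sw.
have pwE : val p <= val w by [].
have /andP[p0 pb] := oivalP p; have /andP[w0 wb] := oivalP w.
pose c := 1 + t; have c0 : 0 < c by rewrite addr_gt0.
(* This is [p - t (w - p)], beyond [p] on the line from [w]. It is nonnegative because
   [t w <= t b <= p <= c p], and below [p] because [p <= w]. *)
pose x : E := c *: val p - t *: val w.
have xE : c *: val p = x + t *: val w by rewrite subrK.
have x0 : 0 <= x.
  rewrite riesz_subr_ge0 scalerDl scale1r.
  apply: le_trans (riesz_scale_le (ltW t0) wb) (le_trans tp _).
  rewrite -riesz_subr_ge0 addrC addKr.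
  exact: ovs_scale_ge0 (ltW t0) p0.
have xp : x <= val p.
  rewrite -riesz_subr_ge0 /x scalerDl scale1r opprB addrCA opprD addNKr.
  by rewrite -scalerBr; apply: ovs_scale_ge0 (ltW t0) _; rewrite riesz_subr_ge0.
have xI : 0 <= x <= b by rewrite x0 (le_trans xp pb).
pose u : order_interval 0 b := OrderInterval xI.
have a01 : 0 <= c^-1 <= 1.
  by rewrite invr_ge0 ltW//= invf_le1// lerDl ltW.
have aC : 1 - c^-1 = c^-1 * t.
  apply: (mulfI (lt0r_neq0 c0)); rewrite mulrBr mulr1 mulrA.
  by rewrite mulfV ?gt_eqF// mul1r addrC addKr.
(* Solving for [p] gives the weights [1/c] on [u] and [t/c] on [w]. *)
have conv_p : order_interval_conv u w a01 = p.
  apply: val_inj; rewrite /= aC -scalerA -scalerDr -xE scalerA mulVf ?gt_eqF//.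
  exact: scale1r.
have Su : (S u <= u)%O.
  (* Concavity multiplied by [c] reads [S u + t w <= c p = x + t w]. *)
  have := cS u w c^-1 a01; rewrite conv_p Sp Sw aC -scalerA -scalerDr.
  move=> /(riesz_scale_le (ltW c0)); rewrite scalerA mulfV ?gt_eqF// scale1r xE.
  by move=> /(ovsD2r (- (t *: val w))); rewrite !addrK.
have px : val p <= x := p_least u Su.
apply/le_anti/andP; split=> //.
suff : val w <= val p by [].
apply: (riesz_scale_le_inv t0).
(* Adding [t w - p] to [p <= x] leaves [t w <= t p]. *)
have := ovsD2r (t *: val w - val p) _ _ px.
rewrite addrCA subrr addr0 addrA -xE /c scalerDl scale1r.
by rewrite addrAC subrr add0r.
Qed.

End OrderIntervals.

Local Open Scope ring_scope.

Theorem theorem5p1 (R : realType) (E : rieszType R) (b : E)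
    (A : adp (order_interval 0 b)) :
  countably_dedekind_complete E ->
  0 < b ->
  regular A ->
  (forall s : policy A, order_continuous (A s)) ->
  (forall s : policy A, concave_on_interval (A s)) ->
  (forall (s : policy A) (v : order_interval 0 b),
      lower_perimeter v -> A s v <> v) ->
  fundamental_optimality A /\
  (VFI_converges A /\
   forall g : order_interval 0 b -> policy A, greedy_selection g ->
     OPI_converges g /\ HPI_converges g).
Proof.
move=> cE b0 regA ocA ccA perA.
have cV := omega_complete_order_interval cE (ltW b0).
have botI : (0 : E) <= 0 <= b by rewrite lexx ltW.
pose bot : order_interval 0 b := OrderInterval botI.
have botP v : (bot <= v)%O by have /andP[] := oivalP v.
have wpA : well_posed A.
  move=> s; have homo := @policy_op_mono _ _ A s.
  have [p ip Ap] := kleene_fixed_point homo cV (@ocA s) (botP _).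
  exists p; split=> // w Aw.
  (* The perimeter hypothesis applies to [p] because [p] is a fixed point. *)
  apply: (concave_fixed_point_unique (ccA s)) => // [/perA/(_ Ap) //|u Au].
  by apply: (increases_to_least ip) => n; exact: iter_le_prefixed homo _ _ _ (botP u) Au.
(* The optimality properties and VFI do not mention a selection, but their proofs go through one. *)
have [g gP] := choice regA.
split; first exact: (well_posed_fundamental_optimality botP cV).
split; first exact: (well_posed_VFI_converges botP cV).
move=> h hP; split.
- exact: (well_posed_OPI_converges botP cV).
- exact: (well_posed_HPI_converges botP cV).
Qed.
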